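(* For each $k \in \omega$ let $X_k$ be a metric space and let $Q_k \subseteq X_k$ be a non-empty perfect set. Let $f_n \colon \prod_{k \in \omega} X_k \to [0,1]$, $n \in \omega$, be any sequence of continuous functions. Then there exist an infinite set $N = \{ n_i \colon i \in \omega \} \subseteq \omega$ and non-empty perfect sets $P_k \subseteq Q_k$ for $k \in \omega$ such that the subsequence $(f_{n_i})_{i \in \omega}$ is pointwise convergent on the product $\prod_{k \in \omega} P_k$.
   Context: $\omega$ denotes the set of natural numbers (including $0$). A subset of a topological space is called perfect if it is compact and has no isolated points (in the subspace topology). Countable products carry the product topology. An infinite set $N = \{n_i \colon i \in \omega\}\subseteq\omega$ is enumerated increasingly. *)

(* Defs.v *)
From HB Require Import structures.
From mathcomp Require Import all_boot all_order all_algebra.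
From mathcomp Require Import all_classical all_reals all_analysis.

Set Implicit Arguments.
Unset Strict Implicit.
Unset Printing Implicit Defensive.

Local Open Scope classical_set_scope.

(* The library's [perfect_set] only asks for closedness instead of compactness.
   [isolated A] is the set of points of [A] that are isolated in the subspace
   topology of [A]. *)
Definition compact_perfect (T : topologicalType) (A : set T) : Prop :=
  compact A /\ isolated A = set0.

(* Main.v *)
Require Import Defs.
From HB Require Import structures.
From mathcomp Require Import all_boot all_order all_algebra.
From mathcomp Require Import all_classical all_reals all_analysis.
From mathcomp Require Import lra.

Import Order.TTheory GRing.Theory Num.Theory.
Import numFieldNormedType.Exports.

Local Open Scope classical_set_scope.
Local Open Scope ring_scope.

(** Embed the Cantor space in each [Q k] by a map [h k] with a uniform modulus of
    continuity. A finite word [u] over the alphabet of the maps [nat -> bool] (one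
    bit for each coordinate) names a point of the product, whose [k]-th coordinate
    is [h k] of the [k]-th bits of the letters of [u] followed by zeros. Sending
    [u] to the value of [f n] at this point, where [n] depends on the length of
    [u] only, tends to infinity with it and is such that [f n] hardly varies once
    that many bits are known, gives a real-valued colouring of words.
    By an infinite Hales-Jewett theorem there are variable words [w 0, w 1, ...]
    such that the colour of [w_0(l_0) w_1(l_1) ... w_n(l_n)] converges as [n] grows,
    for all choices of letters [l_i] in given finite sets. As the [k]-th bits of
    the infinite concatenation depend on the [k]-th bits of the [l_i] only, these
    concatenations name the points of a product of perfect sets.
    The Hales-Jewett theorem is proved with idempotent ultrafilters. *)

(** * Ultrafilters *)

Lemma UltraFilter_setVsetC (T : Type) (F : set_system T) :
  ProperFilter F -> (forall A, F A \/ F (~` A)) -> UltraFilter F.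
Proof.
move=> FF FVC; split=> // G GG FG; apply/seteqP; split=> // A GA.
have [//|/FG GnA] := FVC A.
by have [? []] := filter_ex (filterI GA GnA).
Qed.

Lemma ultra_subset_eq (T : Type) (p q : set_system T) (pU : UltraFilter p)
  (qF : ProperFilter q) : p `<=` q -> q = p.
Proof. exact: max_filter. Qed.

Lemma ultra_fmap (T U : Type) (h : T -> U) (p : set_system T)
  {pU : UltraFilter p} : UltraFilter (h @ p).
Proof.
apply: UltraFilter_setVsetC => A.
by have [|] := in_ultra_setVsetC (h @^-1` A) pU; [left|right].
Qed.

(** If [A] is not in [F], the differences of the members of [F] with [A] generate a proper filter;
    an ultrafilter above it contains [F] but not [A]. *)
Lemma filter_ultraE (T : Type) (F : set_system T) (A : set T) : Filter F ->
  (forall p, UltraFilter p -> F `<=` p -> p A) -> F A.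
Proof.
move=> FF FA; apply: contrapT => nFA.
have pG : ProperFilter (filter_from F (fun B => B `\` A)).
  apply: filter_from_proper.
    apply: filter_from_filter; first by exists setT; apply: filterT.
    move=> B C FB FC; exists (B `&` C); first exact: filterI.
    by move=> x [[Bx Cx] nAx].
  move=> B FB; apply: contrapT => /nonemptyPn BA0; apply: nFA.
  apply: filterS FB => x Bx; apply: contrapT => nAx.
  by rewrite -[False]/(set0 x) -BA0.
have [p [pU Gp]] := ultraFilterLemma pG.
have FGp : F `<=` p by move=> B FB; apply: Gp; exists B => // x [].
have pA := FA p pU FGp.
have pnA : p (~` A) by apply: Gp; exists setT; [exact: filterT|move=> x []].
by have [? []] := filter_ex (filterI pA pnA).
Qed.

(* A filter [F] stands for the closed set of the ultrafilters containing it,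
   so that minimal closed sets correspond to maximal filters. *)
Lemma maximal_filter (T : Type) (Phi : set (set_system T)) (F0 : set_system T) :
  ProperFilter F0 -> Phi F0 ->
  (forall C : set (set_system T), C !=set0 -> C `<=` Phi ->
    Phi (\bigcup_(F in C) F)) ->
  exists F, [/\ ProperFilter F, F0 `<=` F, Phi F &
    forall G, ProperFilter G -> F `<=` G -> Phi G -> G = F].
Proof.
move=> F0F PhiF0 Phi_bigcup.
pose good F := [/\ ProperFilter F, F0 `<=` F & Phi F].
have [C CP Ctot|F [[->|Fgood] Fmax]] :=
    @Zorn_bigcup (set T) (fun F => F = set0 \/ good F).
- have [C0|/nonemptyPn C0] := pselect ((C `&` good) !=set0); last first.
    left; rewrite bigcup0// => F CF; have [//|gF] := CP _ CF.
    by exfalso; rewrite -[False]/(set0 F) -C0.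
  right; have -> : \bigcup_(F in C) F = \bigcup_(F in C `&` good) F.
    apply/seteqP; split=> A [F CF FA].
      have [F0'|gF] := CP _ CF; first by rewrite F0' in FA.
      by exists F.
    by exists F => //; case: CF.
  case: (C0) => F1 [CF1 [F1F F01 PhiF1]]; split.
  + apply: Build_ProperFilter_ex.
      by move=> A [F [_ [FF _ _]]]; apply: filter_ex.
    split; first by exists F1 => //; apply: filterT.
      move=> A B [F [CF gF] FA] [G [CG gG] GB].
      have [FF _ _] := gF; have [GF _ _] := gG.
      have [FG|GF'] := Ctot _ _ CF CG.
        by exists G => //; apply: filterI => //; apply: FG.
      by exists F => //; apply: filterI => //; apply: GF'.
    move=> A B AB [F [CF gF] FA]; exists F => //.
    by have [FF _ _] := gF; apply: filterS FA.
  + by move=> A F0A; exists F1 => //; apply: F01.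
  + by apply: Phi_bigcup => // F [_ []].
- exfalso; apply: (Fmax F0); last by right; split.
  split; first exact: sub0set.
  by move=> /(_ setT); apply; apply: filterT.
case: Fgood => FF F0sF PhiF; exists F; split=> // G GF FG PhiG.
apply: contrapT => GneF; apply: (Fmax G); last first.
  by right; split=> //; apply: subset_trans FG.
by split=> // GF'; apply: GneF; apply/seteqP.
Qed.

(** * The semigroup of ultrafilters *)

Section ultrafilter_semigroup.
Variables (T : Type) (op : T -> T -> T).
Hypothesis opA : associative op.

(** The extension of [op] to the Stone-Cech compactification of the discrete [T]. It is defined for
    filters too: for an ultrafilter [q], [F ** q] codes the closed set of all [p ** q] with [p] an
    ultrafilter above [F]. *)
Definition ufmul (p q : set_system T) : set_system T :=
  fun A => p (fun s => q (fun t => A (op s t))).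

#[local] Typeclasses Opaque ufmul.
Local Infix "**" := ufmul (at level 40, left associativity).

Lemma ufmulA p q r : p ** (q ** r) = p ** q ** r.
Proof.
apply/funext => A; rewrite /ufmul; congr p; apply/funext => s.
by congr q; apply/funext => t; congr r; apply/funext => u; rewrite opA.
Qed.

Instance ufmul_filter p q {pF : Filter p} {qF : Filter q} : Filter (p ** q).
Proof.
rewrite /ufmul; split.
- by apply: filterE => s; apply: filterT.
- move=> A B; apply: filterS2 => s; exact: filterI.
- by move=> A B AB; apply: filterS => s; apply: filterS => t; apply: AB.
Qed.

Instance ufmul_proper p q {pF : ProperFilter p} {qF : ProperFilter q} :
  ProperFilter (p ** q).
Proof.
apply: Build_ProperFilter_ex.
move=> A; rewrite /ufmul => /filter_ex [s /filter_ex [t Ast]].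
by exists (op s t).
Qed.

Lemma ufmul_ultra p q (pU : UltraFilter p) (qU : UltraFilter q) :
  UltraFilter (p ** q).
Proof.
apply: UltraFilter_setVsetC.
move=> A; have [pA|pnA] := in_ultra_setVsetC (fun s => q (fun t => A (op s t))) pU.
  by left.
right; apply: filterS pnA => s nqA.
by have [//|] := in_ultra_setVsetC (fun t => A (op s t)) qU.
Qed.

Lemma ufmulSl p p' q : p `<=` p' -> p ** q `<=` p' ** q.
Proof. by move=> pp' A; apply: pp'. Qed.

(* Right translations of the space of ultrafilters are closed maps. *)
Lemma ufmul_factor F q u : ProperFilter F -> UltraFilter q -> UltraFilter u ->
  F ** q `<=` u -> exists p, [/\ UltraFilter p, F `<=` p & u = p ** q].
Proof.
move=> FF qU uU Fqu.
(* An ultrafilter above the filter generated by these sets contains [F], and its product with [q]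
   contains every [C] in [u]. *)
pose B (AC : set T * set T) := AC.1 `&` [set s | q (fun t => AC.2 (op s t))].
pose G := filter_from (fun AC : set T * set T => F AC.1 /\ u AC.2) B.
have GF : ProperFilter G.
  apply: filter_from_proper.
    apply: filter_from_filter; first by exists (setT, setT); split; apply: filterT.
    move=> [A C] [A' C'] /= [FA uC] [FA' uC'].
    exists (A `&` A', C `&` C'); first by split; apply: filterI.
    move=> s [/= [As A's] qCC']; split; split => //=.
      by apply: filterS qCC' => t [].
    by apply: filterS qCC' => t [].
  move=> [A C] /= [FA uC]; apply: contrapT => /nonemptyPn AC0.
  have /Fqu unC : (F ** q) (~` C).
    apply: filterS FA => s As.
    have [qC|//] := in_ultra_setVsetC (fun t => C (op s t)) qU.
    by exfalso; rewrite -[False]/(set0 s) -AC0.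
  by have [? []] := filter_ex (filterI uC unC).
have [p [pU Gp]] := ultraFilterLemma GF; exists p; split=> //.
  move=> A FA; apply: Gp; exists (A, setT); last by move=> s [].
  by split=> //; apply: filterT.
apply/esym/(@ultra_subset_eq _ u (p ** q) _ _).
move=> C uC; apply: Gp; exists (setT, C); last by move=> s [].
by split=> //; apply: filterT.
Qed.

Definition uf_subsemigroup (F : set_system T) := forall p q,
  UltraFilter p -> UltraFilter q -> F `<=` p -> F `<=` q -> F `<=` p ** q.

(** For [q] in a minimal closed subsemigroup [M], the closed subsemigroup [M ** q] of [M] is all of
    [M], so some [x] in [M] has [x ** q = q]. Such [x] again form a closed subsemigroup, hence all
    of [M], and [q] is one of them. *)
Lemma ellis_numakura F : ProperFilter F -> uf_subsemigroup F ->
  exists p, [/\ UltraFilter p, F `<=` p & p ** p = p].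
Proof.
move=> FF Fsemi.
have [|M [MF FM Msemi Mmax]] := maximal_filter _ uf_subsemigroup F FF Fsemi.
  move=> C _ Csemi p q pU qU Cp Cq A [G CG GA].
  by apply: Csemi GA => // B GB; [apply: Cp|apply: Cq]; exists G.
have [q [qU Mq]] := ultraFilterLemma MF.
have MqE : M ** q = M.
  apply: (Mmax _ (ufmul_proper _ _)).
    move=> A MA; apply: filter_ultraE => u uU Mu.
    have [x [xU Mx ->]] := ufmul_factor _ _ _ MF qU uU Mu.
    exact: (Msemi x q).
  move=> u v uU vU Mu Mv.
  have [x [xU Mx ->]] := ufmul_factor _ _ _ MF qU uU Mu.
  have [y [yU My ->]] := ufmul_factor _ _ _ MF qU vU Mv.
  rewrite ufmulA; apply: ufmulSl; rewrite -ufmulA.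
  by apply: (Msemi x (q ** y)) => //; [exact: ufmul_ultra|exact: Msemi].
pose fixes x := [/\ UltraFilter x, M `<=` x & q = x ** q].
have [x0 x0fix] : exists x, fixes x by apply: ufmul_factor => //; rewrite MqE.
have [x0U _ _] := x0fix.
pose G : set_system T := fun A => forall x, fixes x -> x A.
have MG : M `<=` G by move=> A MA x [_ Mx _]; exact: Mx.
have GF : ProperFilter G.
  apply: Build_ProperFilter_ex => [A /(_ x0) x0A|].
    by apply: (@filter_ex _ x0 _ A); apply: x0A.
  split=> [x [xU _ _]|A B GA GB x fx|A B AB GA x fx]; first exact: filterT.
    by have [xU _ _] := fx; apply: filterI; [exact: GA|exact: GB].
  by have [xU _ _] := fx; apply: filterS AB _; exact: GA.
(* The set [fixes] is closed: it contains every ultrafilter above the intersection [G] of its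
   members. *)
have Gfixes u : UltraFilter u -> G `<=` u -> fixes u.
  move=> uU Gu; split => //; first exact: subset_trans Gu.
  apply/esym/(@ultra_subset_eq _ q (u ** q) _ _).
  by move=> A qA; apply: Gu => x [_ _ qE]; move: qA; rewrite {1}qE.
have GE : G = M.
  apply: (Mmax G GF) => // u v uU vU Gu Gv A GA.
  have [_ Mu qu] := Gfixes u uU Gu; have [_ Mv qv] := Gfixes v vU Gv.
  apply: GA; split; [exact: ufmul_ultra|exact: Msemi|].
  by rewrite -ufmulA -qv -qu.
exists q; split=> //; first exact: subset_trans Mq.
by have [_ _ <-] : fixes q by apply: Gfixes; rewrite ?GE.
Qed.

(* [p] generates a minimal left ideal of the ultrafilters on [S]; an idempotent
   [q <= p] is found in the ideal of the ultrafilters on [I], and minimality of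
   [p] forces each retract of [q] to be [p]. *)
Lemma variable_word_ultrafilter (S I : set T) (Sigma : set (T -> T)) :
  S !=set0 -> I !=set0 ->
  (forall s t, S s -> S t -> S (op s t)) ->
  (forall s t, I s -> I (op s t)) -> (forall s t, I t -> I (op s t)) ->
  (forall h, Sigma h -> [/\ {morph h : s t / op s t},
    forall t, S (h t) & forall s, S s -> h s = s]) ->
  exists p q, [/\ UltraFilter p, UltraFilter q, p ** p = p, p S & q I /\
    forall h, Sigma h -> h @ q = p].
Proof.
move=> [s0 Ss0] [i0 Ii0] Sop Iopl Iopr SigmaP.
pose left_ideal (F : set_system T) := forall u m, UltraFilter u -> UltraFilter m ->
  u S -> F `<=` m -> F `<=` u ** m.
have [||M [MF SM Mleft Mmax]] :=
    maximal_filter _ left_ideal (globally S) (globally_properfilter Ss0).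
- move=> u m uU mU uS Sm A SA; rewrite /ufmul.
  have mS : m S by apply: Sm.
  by apply: filterS uS => s Ss; apply: filterS mS => t St; apply/SA/Sop.
- move=> C _ Cleft u m uU mU uS Cm A [F CF FA].
  by apply: Cleft FA => // B FB; apply: Cm; exists F.
have MS : M S by apply: SM.
have [|p [pU Mp pp]] := ellis_numakura M MF.
  by move=> u v uU vU Mu Mv; apply: Mleft => //; apply: Mu.
have pS : p S by apply: Mp.
(* The products [b ** p] with [b] on [I] form a closed subsemigroup; an idempotent [e] in it
   satisfies [e ** p = e]. *)
have F1F : ProperFilter (globally I ** p).
  by apply: ufmul_proper => //; exact: globally_properfilter Ii0.
have IF : ProperFilter (globally I) by exact: globally_properfilter Ii0.
have [|e [eU Fe ee]] := ellis_numakura _ F1F.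
  move=> u v uU vU Fu Fv.
  have [b [bU Ib ->]] := ufmul_factor _ _ _ IF pU uU Fu.
  have [c [cU Ic ->]] := ufmul_factor _ _ _ IF pU vU Fv.
  rewrite ufmulA; apply: ufmulSl => A IA.
  have bI : b I by apply: Ib.
  rewrite -ufmulA /ufmul; apply: filterS bI => s Is.
  by apply: filterE => t; apply: filterE => t'; apply/IA/Iopl.
have [b [bU Ib eE]] := ufmul_factor _ _ _ IF pU eU Fe.
have bI : b I by apply: Ib.
have ep : e ** p = e by rewrite eE -ufmulA pp.
have eI : e I.
  by rewrite eE /ufmul; apply: filterS bI => s Is; apply: filterE => t; apply: Iopl.
(* Multiplying [e] by [p] on the left gives an idempotent on which [p] acts as an identity from both
   sides. *)
exists p, (p ** e); split => //; first exact: ufmul_ultra.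
split.
  by rewrite /ufmul; apply: filterE => s; apply: filterS eI => t; apply: Iopr.
move=> h /SigmaP[hM hS hid].
have fmapM u v : h @ (u ** v) = (h @ u) ** (h @ v).
  apply/funext => A; rewrite /ufmul /= /fmap /=; congr u; apply/funext => s /=.
  by congr v; apply/funext => t /=; rewrite hM.
have hp : h @ p = p.
  apply: (@ultra_subset_eq _ p (h @ p) _ _) => A pA.
  suff: p (h @^-1` A) by [].
  by apply: filterS2 pS pA => s Ss; rewrite /preimage/= hid.
set r := h @ (p ** e).
have rU : UltraFilter r by apply: ultra_fmap; apply: ufmul_ultra.
have rE : r = p ** (h @ e) by rewrite /r fmapM hp.
have rp : r ** p = r by rewrite /r -{2}hp -fmapM -ufmulA ep.
have pr : p ** r = r by rewrite rE ufmulA pp.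
have rr : r ** r = r.
  by rewrite /r -fmapM ufmulA -(ufmulA p e p) ep -ufmulA ee.
have rS : r S.
  suff: (p ** e) (h @^-1` S) by [].
  have -> : h @^-1` S = setT by apply/seteqP; split=> // t _; exact: hS.
  exact: (@filterT _ (p ** e) _).
have Mr : M `<=` r by rewrite -rp; apply: Mleft.
have MrE : M ** r = M.
  apply: (Mmax _ (ufmul_proper _ _)).
    move=> A MA; apply: filter_ultraE => u uU Mu.
    have [x [xU Mx ->]] := ufmul_factor _ _ _ MF rU uU Mu.
    by apply: (Mleft x r) => //; apply: Mx.
  move=> u m uU mU uS Mm.
  have [x [xU Mx ->]] := ufmul_factor _ _ _ MF rU mU Mm.
  by rewrite ufmulA; apply: ufmulSl; apply: Mleft.
(* Minimality allows [p] to be written as [x ** r]. As [r] is idempotent, [p ** r = p], whereas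
   [p ** r = r]. *)
have [|x [xU Mx pE]] := ufmul_factor M r p MF rU pU; first by rewrite MrE.
by rewrite -pr {1}pE -ufmulA rr -pE.
Qed.

End ultrafilter_semigroup.

(** * The infinite Hales-Jewett theorem *)

Lemma ultra_itv_cvg (R : realType) (T : Type) (p : set_system T) (g : T -> R) :
  UltraFilter p -> (forall x, g x \in `[0, 1]) ->
  exists2 c : R, c \in `[0, 1] & g @ p --> c.
Proof.
move=> pU g01; have gpU := @ultra_fmap _ _ g p pU.
have := @segment_compact R 0 1; rewrite compact_ultra => /(_ (g @ p) gpU) [|c].
  suff: p (g @^-1` `[0, 1]%classic) by [].
  by apply: filterE => x; exact: g01.
by move=> [c01 gc]; exists c.
Qed.

(** Adding to [a n] the bound [2 * 2^-1 ^+ n] on the sum of all later steps gives a nonincreasing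
    sequence that is bounded below. *)
Lemma cvgn_geometric_steps (R : realType) (a : nat -> R) :
  (forall n, 0 <= a n) -> (forall n, `|a n - a n.+1| <= 2^-1 ^+ n) -> cvgn a.
Proof.
move=> a0 aD; pose b n := a n + 2 * 2^-1 ^+ n.
have g0 : 2 * 2^-1 ^+ n @[n --> \oo] --> (0 : R).
  rewrite -(mulr0 2); apply: cvgMr; apply: cvg_expr.
  by rewrite ger0_norm; lra.
have bcvg : cvgn b.
  apply: nonincreasing_is_cvgn.
    apply/nonincreasing_seqP => n; rewrite /b exprS mulrA divff// mul1r.
    by have := aD n; rewrite ler_norml => /andP[h _]; lra.
  exists 0 => _ [n _ <-]; apply: addr_ge0 => //; exact: mulr_ge0.
rewrite (_ : a = b \- (fun n => 2 * 2^-1 ^+ n)).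
  by apply: is_cvgB => //; apply: cvgP g0.
by apply/funext => n; rewrite /b /= addrK.
Qed.

Lemma filter_finite_forall (T : Type) (I : choiceType) (F : set_system T)
    (D : set I) (A : I -> set T) : Filter F -> finite_set D ->
  (forall i, D i -> F (A i)) -> F [set x | forall i, D i -> A i x].
Proof.
move=> FF finD FA; rewrite -[D]fset_setK//.
apply: (@filter_bigI _ _ (fset_set D) A F) => i.
by rewrite in_fset_set// => /set_mem; exact: FA.
Qed.

(** The letter [None] is the variable of a variable word. *)
Definition subst {L : Type} (a : L) (w : seq (option L)) : seq L :=
  map (odflt a) w.

Definition subst_prefix {L : Type} (w : nat -> seq (option L)) (l : nat -> L)
  (n : nat) : seq L := flatten [seq subst (l i) (w i) | i <- iota 0 n].

Lemma subst_prefixS (L : Type) (w : nat -> seq (option L)) (l : nat -> L) n :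
  subst_prefix w l n.+1 = subst_prefix w l n ++ subst (l n) (w n).
Proof.
by rewrite /subst_prefix -addn1 iotaD map_cat flatten_cat /= cats0 add0n.
Qed.

(** Let [c s] be the limit of the colours of [s ++ t] as [t] runs along [p]. Only finitely many
    prefixes [s] and letters occur at stage [n], so one [w n] serves them all: substituting any of
    the letters keeps both the colour and [c] within [2^-1 ^+ n] of [c s]. *)
Lemma infinite_hales_jewett (R : realType) (L : choiceType) (F : seq L -> R)
    (A : nat -> set L) :
  (forall u, F u \in `[0, 1]) -> (forall i, finite_set (A i)) ->
  exists w : nat -> seq (option L), (forall i, None \in w i) /\
    forall l : nat -> L, (forall i, A i (l i)) ->
      cvgn (fun n => F (subst_prefix w l n)).
Proof.
move=> F01 finA.
pose T := seq (option L).
pose emb : seq L -> T := map Some.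
have embK : cancel emb (pmap id) by elim=> //= x s ->.
have [|||||| p [q [pU qU pp pS [qI qp]]]] :=
  @variable_word_ultrafilter T cat (@catA _) (range emb) [set w : T | None \in w]
    (range (fun a w => emb (subst a w))).
- by exists [::]; exists [::].
- by exists [:: None]; rewrite /= inE.
- by move=> _ _ [s _ <-] [t _ <-]; exists (s ++ t); rewrite /emb ?map_cat.
- by move=> s t /=; rewrite mem_cat => ->.
- by move=> s t /=; rewrite mem_cat => ->; rewrite orbT.
- move=> _ [a _ <-]; split.
  + by move=> s t; rewrite /subst /emb !map_cat.
  + by move=> t; exists (subst a t).
  + by move=> _ [s _ <-]; rewrite /emb /subst -!map_comp.
pose G (s : T) := F (pmap id s).
have /choice [c cP] : forall s, exists d : R,
    d \in `[0, 1] /\ (fun t => G (s ++ t)) @ p --> d.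
  move=> s; have [d d01 Gd] := ultra_itv_cvg _ _ p (fun t => G (s ++ t)) pU
    (fun t => F01 _).
  by exists d.
(* Idempotency of [p] makes [c (s ++ t)] tend to [c s] along [p]; the limits [c]
   are allowed to drift, which avoids any intersection of countably many members
   of [p]. *)
have c_lim s e : 0 < e -> p [set t | `|c s - c (s ++ t)| < e].
  move=> e0; have e2 : 0 < e / 2 by lra.
  have [_ /cvgrPdist_lt/(_ _ e2) pG] := cP s.
  have {pG}: ufmul T cat p p [set t | `|c s - G (s ++ t)| < e / 2].
    by rewrite pp.
  rewrite /ufmul => pG; apply: filterS pG => t pGt.
  have [_ /cvgrPdist_lt/(_ _ e2) pGst] := cP (s ++ t).
  have [u []] := filter_ex (filterI pGt pGst).
  rewrite /= catA !ltr_norml => /andP[h1 h2] /andP[h3 h4].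
  by apply/andP; split; lra.
(* [Ei] pairs a set of prefixes with a stage. Finiteness is a premise inside the existential so that
   [choice] applies to all pairs. *)
have step (Ei : set T * nat) : exists w : T, finite_set Ei.1 ->
    None \in w /\ forall sa, (Ei.1 `*` A Ei.2) sa ->
    let t := sa.1 ++ emb (subst sa.2 w) in
    `|c sa.1 - G t| < 2^-1 ^+ Ei.2 /\ `|c sa.1 - c t| < 2^-1 ^+ Ei.2.
  have [finE|] := pselect (finite_set Ei.1); last by exists [::].
  have e0 : 0 < 2^-1 ^+ Ei.2 :> R by rewrite exprn_gt0// invr_gt0.
  suff /filter_ex [w [w1 w2]] : q ([set w : T | None \in w] `&`
      [set w | forall sa, (Ei.1 `*` A Ei.2) sa ->
        let t := sa.1 ++ emb (subst sa.2 w) in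
        `|c sa.1 - G t| < 2^-1 ^+ Ei.2 /\ `|c sa.1 - c t| < 2^-1 ^+ Ei.2]).
    by exists w.
  apply: filterI => //; apply: filter_finite_forall.
    exact: finite_setX.
  move=> [s a] [/= _ Aa].
  have : p [set t | `|c s - G (s ++ t)| < 2^-1 ^+ Ei.2 /\
                    `|c s - c (s ++ t)| < 2^-1 ^+ Ei.2].
    apply: filterI; last exact: c_lim.
    by have [_ /cvgrPdist_lt/(_ _ e0)] := cP s.
  (* Substituting [a] sends [q] to [p], so what holds along [p] holds along [q] after
     substitution. *)
  by rewrite -(qp (fun w => emb (subst a w)))//; exists a.
have [W WP] := choice step.
pose E := fix E i : set T := if i is j.+1
  then [set sa.1 ++ emb (subst sa.2 (W (E j, j))) | sa in E j `*` A j]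
  else [set [::]].
have finE i : finite_set (E i).
  elim: i => [|i IH] /=; first exact: finite_set1.
  by apply: finite_image; apply: finite_setX.
pose w i := W (E i, i); exists w; split.
  by move=> i; have [] := WP (E i, i) (finE i).
move=> l Al; pose u n := emb (subst_prefix w l n).
have uS n : u n.+1 = u n ++ emb (subst (l n) (w n)).
  by rewrite /u subst_prefixS /emb map_cat.
have uE n : E n (u n).
  elim: n => // n IH; rewrite uS; exists (u n, l n) => //; split => //.
have uP n : `|c (u n) - G (u n.+1)| < 2^-1 ^+ n /\
            `|c (u n) - c (u n.+1)| < 2^-1 ^+ n.
  rewrite uS; have [_ h] := WP (E n, n) (finE n).
  by apply: (h (u n, l n)); split.
have cu : cvgn (fun n => c (u n)).
  apply: cvgn_geometric_steps => n; last by have [_ /ltW] := uP n.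
  by have [] := cP (u n); rewrite in_itv/= => /andP[].
have GE n : G (u n) = F (subst_prefix w l n) by rewrite /G /u embK.
(* The estimates compare the colour at stage [n.+1] with [c] at stage [n], whence the shift. *)
apply/cvg_ex; exists (limn (fun n => c (u n))).
rewrite -cvg_shiftS /=.
under eq_fun do rewrite -GE.
have -> : (fun n => G (u n.+1)) = (fun n => c (u n)) \- (fun n => c (u n) - G (u n.+1)).
  by apply/funext => n /=; rewrite subKr.
rewrite -[limn _]subr0; apply: cvgB => //.
apply: norm_cvg0; apply: (@squeeze_cvgr _ _ _ _ (fun=> 0) (fun n => 2^-1 ^+ n)).
- by apply: nearW => n; rewrite normr_ge0 /=; have [/ltW] := uP n.
- exact: cvg_cst.
- by apply: cvg_expr; rewrite ger0_norm; lra.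
Qed.

(** * Perfect sets and products of compact sets *)

Lemma exp_half_lt (R : realType) (e : R) : 0 < e ->
  exists N, forall n, (N <= n)%N -> 2^-1 ^+ n < e.
Proof.
move=> e0; have : 2^-1 ^+ n @[n --> \oo] --> (0 : R).
  by apply: cvg_expr; rewrite ger0_norm; lra.
move=> /cvgrPdist_lt/(_ _ e0)[N _ NP]; exists N => n /NP /=.
by rewrite sub0r normrN ger0_norm// exprn_ge0// invr_ge0.
Qed.

(** A binary tree of balls: the children of a ball are centred at its centre and at a second point
    of [Q] near it, which exists since the centre is not isolated. A branch is sent to a cluster
    point of its centres. *)
Lemma cantor_scheme (R : realType) (X : metricType R) (Q : set X) :
  Q !=set0 -> compact_perfect Q ->
  exists h : (nat -> bool) -> X, [/\ forall x, Q (h x), injective h &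
    forall n x y, (forall i, (i < n)%N -> x i = y i) ->
      mdist (h x) (h y) < 2^-1 ^+ n].
Proof.
move=> [q0 Qq0] [Qcompact Qperfect].
have /choice [pick pickP] : forall ar : X * R, exists y, Q ar.1 -> 0 < ar.2 ->
    Q y /\ 0 < mdist ar.1 y < ar.2.
  move=> [a r] /=; have [Qa|] := pselect (Q a); last by exists a.
  have [r0|] := pselect (0 < r); last by exists a.
  apply: contrapT => /forallNP noy.
  suff : isolated Q a by rewrite Qperfect.
  split; first exact: mem_set.
  exists (ball a r); first exact: nbhsx_ballx.
  apply/seteqP; split=> [y [ay Qy]|_ ->]; last by split=> //; exact: ballxx.
  apply: contrapT => yNa; apply: (noy y) => _ _; split=> //.
  rewrite ballEmdist in ay; rewrite ay andbT mdist_gt0.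
  by apply/eqP => ya; apply: yNa.
(* Here [d] is the distance between the centres of the children, less than half the radius; the
   radius [d / 4] keeps the children disjoint and inside their parent. *)
pose d (ar : X * R) := mdist ar.1 (pick (ar.1, ar.2 / 2)).
pose next (ar : X * R) (b : bool) : X * R :=
  (if b then pick (ar.1, ar.2 / 2) else ar.1, d ar / 4).
(* The initial radius [1 / 4] makes any two points of a ball at depth [n] closer than
   [2^-1 ^+ n]. *)
pose node := fix node (x : nat -> bool) n : X * R :=
  if n is m.+1 then next (node x m) (x m) else (q0, 1 / 4).
have nodeP x n : Q (node x n).1 /\ 0 < (node x n).2.
  elim: n => [|n [IH1 IH2]] /=; first by split=> //; lra.
  have [|Qy /andP[y1 _]] := pickP ((node x n).1, (node x n).2 / 2) IH1.
    by rewrite /=; lra.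
  by split; [case: (x n)|rewrite /d; move: y1 => /=; lra].
have dP x n : 0 < d (node x n) < (node x n).2 / 2.
  have [Qa r0] := nodeP x n.
  have [|//] := pickP ((node x n).1, (node x n).2 / 2) Qa.
  by rewrite /=; lra.
have rS x n : (node x n.+1).2 = d (node x n) / 4 by [].
have aS x n : mdist (node x n).1 (node x n.+1).1 <= d (node x n).
  rewrite /= /d; case: (x n) => //=; rewrite mdistxx; exact: mdist_ge0.
have aD x n m : mdist (node x n).1 (node x (n + m)%N).1 <= (node x n).2.
  elim: m n => [|m IH] n.
    by rewrite addn0 mdistxx; have [_ /ltW] := nodeP x n.
  have h1 := metric_triangle (node x n).1 (node x n.+1).1 (node x (n + m.+1)%N).1.
  have h2 := IH n.+1; rewrite addSnnS rS in h2.
  by have := aS x n; have /andP[] := dP x n; lra.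
have r_le x n : (node x n).2 <= 1 / 4 * 2^-1 ^+ n.
  elim: n => [|n IH]; first by rewrite expr0 mulr1.
  by rewrite rS exprS; have /andP[] := dP x n; lra.
have /choice [h hP] : forall x, exists p, Q p /\
    forall n, mdist (node x n).1 p <= (node x n).2.
  move=> x; have [|p [Qp clp]] := Qcompact ((fun n => (node x n).1) @ \oo) _.
    by exists 0%N => // n _ /=; have [] := nodeP x n.
  exists p; split=> // n; apply/ler_addgt0Pr => e e0.
  have [|_ [[m nm <-]]] := clp [set (node x m).1 | m in [set m | (n <= m)%N]]
    (ball p e) _ (nbhsx_ballx p e e0).
    by exists n => // m nm; exists m.
  rewrite ballEmdist /= => pm.
  have h1 := metric_triangle (node x n).1 (node x m).1 p.
  have := aD x n (m - n)%N; rewrite subnKC// => h2.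
  by rewrite metric_sym in pm; lra.
have node_eq x y n : (forall i, (i < n)%N -> x i = y i) -> node x n = node y n.
  elim: n => //= n IH xy; rewrite IH ?xy// => i ?; apply: xy.
  exact: ltnW.
exists h; split.
- by move=> x; have [] := hP x.
- move=> x y hxy; apply: contrapT => /eqP xNy.
  have exN : exists n, x n != y n.
    apply: contrapT => /forallNP nxy; move/eqP: xNy; apply.
    by apply/funext => n; apply/eqP; apply/negPn/negP; exact: nxy.
  case: (ex_minnP exN) => n xyn minn.
  have eqn : node x n = node y n.
    apply: node_eq => i ltin; apply/eqP; apply: contraTT ltin => xyi.
    by rewrite -leqNgt; apply: minn.
  have [_ hx] := hP x; have [_ hy] := hP y.
  have /= := hx n.+1; have /= := hy n.+1; rewrite -eqn hxy.
  have /andP[d0 _] := dP x n.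
  have h1 := metric_triangle (node x n).1 (h y) (pick ((node x n).1, (node x n).2 / 2)).
  have s1 := metric_sym (h y) (pick ((node x n).1, (node x n).2 / 2)).
  rewrite -/(d (node x n)) in h1.
  by move: xyn; case: (x n) (y n) => -[]//= _; lra.
- move=> n x y xy; have [_ /(_ n) hx] := hP x; have [_ /(_ n)] := hP y.
  rewrite -(node_eq _ _ _ xy) => hy.
  have h1 := metric_triangle (h x) (node x n).1 (h y).
  have s1 := metric_sym (h x) (node x n).1.
  have : 0 < 2^-1 ^+ n :> R by rewrite exprn_gt0// invr_gt0.
  by have := r_le x n; lra.
Qed.

(** The thickenings of the neighbourhoods of [a] generate a filter. Its convergence to [a] can be
    checked one coordinate at a time, where the triangle inequality suffices. *)
Lemma nbhs_prod_topology_mdist (R : realType) (X : nat -> metricType R)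
    (a : prod_topology X) (W : set (prod_topology X)) : nbhs a W ->
  exists2 V : set (prod_topology X), nbhs a V & exists N : nat, forall x y n,
    V x -> (N <= n)%N -> (forall k, mdist (x k) (y k) < 2^-1 ^+ n) -> W y.
Proof.
pose U (VN : set (prod_topology X) * nat) : set (prod_topology X) :=
  [set y | exists x n, [/\ VN.1 x, (VN.2 <= n)%N &
    forall k, mdist (x k) (y k) < 2^-1 ^+ n]].
pose G := filter_from (fun VN => nbhs a VN.1) U.
have GF : Filter G.
  apply: filter_from_filter; first by exists (setT, 0%N); exact: filterT.
  move=> [V N] [V' N'] /= aV aV'; exists (V `&` V', maxn N N'); first exact: filterI.
  move=> y [x [n [/= [Vx V'x]]]]; rewrite geq_max => /andP[Nn N'n] xy.
  by split; exists x, n.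
suff Ga : G --> a.
  move=> aW; have [[V N] /= aV VNW] := Ga _ aW.
  by exists V => //; exists N => x y n Vx Nn xy; apply: VNW; exists x, n.
apply/cvg_sup => k; apply/cvg_image.
  by apply/seteqP; split=> // y _; exists (dfwith a k y) => //; rewrite dfwithin.
move=> B /nbhs_ballP [e /= e0 aB].
have e2 : 0 < e / 2 by lra.
exists (@proj _ X k @^-1` B); last first.
  by rewrite image_preimage//; apply/seteqP; split=> // y _;
    exists (dfwith a k y) => //; rewrite /proj dfwithin.
have [N NP] := exp_half_lt _ _ e2.
exists (@proj _ X k @^-1` ball (a k) (e / 2), N).
  by apply: proj_continuous; exact: nbhsx_ballx.
move=> y [x [n [/= ax Nn xy]]]; apply: aB.
rewrite (splitr e); apply: ball_triangle ax _.
by rewrite ballEmdist /=; apply: lt_trans (NP n Nn).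
Qed.

(** Uniform continuity on a compact product, from Tychonoff's theorem: the estimate holds near each
    point for all large [n], and compactness makes the bound on [n] uniform. *)
Lemma compact_prod_modulus (R : realType) (X : nat -> metricType R)
    (Q : forall k, set (X k)) (f : prod_topology X -> R) (e : R) :
  (forall k, compact (Q k)) -> continuous f -> 0 < e ->
  exists N : nat, forall n (x y : prod_topology X), (N <= n)%N ->
    (forall k, Q k (x k)) -> (forall k, mdist (x k) (y k) < 2^-1 ^+ n) ->
    `|f x - f y| <= e.
Proof.
move=> Qcompact fcont e0.
have := tychonoff Qcompact; rewrite compact_near_coveringP.
pose P (n : nat) (x : prod_topology X) := forall y : prod_topology X,
  (forall k, mdist (x k) (y k) < 2^-1 ^+ n) -> `|f x - f y| <= e.
move=> /(_ nat \oo P _) [].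
  move=> a _.
  have e2 : 0 < e / 2 by lra.
  have /nbhs_prod_topology_mdist [V aV [N NP]] :
      nbhs a (f @^-1` [set r | `|f a - r| < e / 2]).
    by have /cvgrPdist_lt/(_ _ e2) := fcont a.
  exists ((V `&` f @^-1` [set r | `|f a - r| < e / 2]), [set n | (N <= n)%N]).
    split; last by exists N.
    by apply: filterI => //; have /cvgrPdist_lt/(_ _ e2) := fcont a.
  move=> [x n] [[/= Vx fx] Nn] y xy.
  have := NP _ _ _ Vx Nn xy; move: fx; rewrite /= !ltr_norml ler_norml.
  by move=> /andP[h1 h2] /andP[h3 h4]; apply/andP; split; lra.
by move=> N _ NP; exists N => n x y Nn Qx xy; exact: (NP n Nn x Qx).
Qed.

(** Compactness is inherited from the Cantor space. No [g x] is isolated: changing [x] suitably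
    beyond place [n] moves [g x], but by less than [2^-1 ^+ n]. *)
Lemma cantor_range_compact_perfect (R : realType) (X : metricType R)
    (g : (nat -> bool) -> X) :
  (forall n x y, (forall i, (i < n)%N -> x i = y i) ->
    mdist (g x) (g y) < 2^-1 ^+ n) ->
  (forall n x, exists y, (forall i, (i < n)%N -> x i = y i) /\ g y <> g x) ->
  compact_perfect (range g).
Proof.
move=> gmod gsplit; split.
  apply: (@continuous_compact cantor_space); last exact: cantor_space_compact.
  apply: continuous_subspaceT => x B /nbhs_ballP [e /= e0 xB].
  have [N NP] := exp_half_lt _ _ e0.
  have : nbhs (x : cantor_space) [set y | forall i, `I_N i -> x i = y i].
    apply: (@filter_finite_forall _ nat _ `I_N (fun i y => x i = y i)).
      exact: finite_II.
    move=> i _; have : nbhs (x i) [set x i] by exact: discrete_set1.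
    move=> /(@proj_continuous nat (fun=> bool) i x).
    by apply: filterS => y /= ->.
  apply: filterS => y xy; apply: xB; rewrite ballEmdist /=.
  by apply: lt_trans (NP N (leqnn N)); exact: gmod.
apply/seteqP; split=> // _ [/set_mem [x _ <-]] [V /nbhs_ballP [e /= e0 xV] VE].
have [N NP] := exp_half_lt _ _ e0.
have [y [xy gyx]] := gsplit N x.
apply: gyx; suff : (V `&` range g) (g y) by rewrite VE.
split; last by exists y.
apply: xV; rewrite ballEmdist /=.
by apply: lt_trans (NP N (leqnn N)); exact: gmod.
Qed.

(** * Infinite concatenations *)

Section stream.
Variables (w : nat -> seq (option (nat -> bool))).
Hypothesis w_var : forall i, None \in w i.

Implicit Types l : nat -> nat -> bool.

(** Substitution acts letter by letter and so commutes with taking [k]-th bits; this makes the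
    coordinates of a concatenation independent of each other. *)
Lemma subst_prefix_proj l l' n k : (forall i, (i < n)%N -> l i k = l' i k) ->
  map (fun a => a k) (subst_prefix w l n) =
  map (fun a => a k) (subst_prefix w l' n).
Proof.
elim: n => [//|n IH] ll'; rewrite !subst_prefixS !map_cat IH => [|i ltin].
  congr (_ ++ _); rewrite /subst -!map_comp; apply: eq_map => -[a|] //=.
  exact: ll'.
by apply: ll'; rewrite ltnW.
Qed.

Lemma size_subst_prefix l l' n :
  size (subst_prefix w l n) = size (subst_prefix w l' n).
Proof.
elim: n => [//|n IH].
by rewrite !subst_prefixS !size_cat IH /subst !size_map.
Qed.

Lemma leq_size_subst_prefix l n : (n <= size (subst_prefix w l n))%N.
Proof.
elim: n => [//|n IH]; rewrite subst_prefixS size_cat -addn1 leq_add//.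
by rewrite /subst size_map; case: (w n) (w_var n).
Qed.

Lemma nth_subst_prefix l n m j a0 : (n <= m)%N ->
  (j < size (subst_prefix w l n))%N ->
  nth a0 (subst_prefix w l m) j = nth a0 (subst_prefix w l n) j.
Proof.
move=> /subnKC <- ltj; elim: (m - n)%N => [|d IH]; first by rewrite addn0.
rewrite addnS subst_prefixS nth_cat IH ifT//; apply: leq_trans ltj _.
elim: d {IH} => [|d IH]; first by rewrite addn0.
by rewrite addnS subst_prefixS size_cat (leq_trans IH)// leq_addr.
Qed.

(** The infinite concatenation. Every block contains a variable and so is nonempty, hence [j.+1]
    blocks reach position [j]. *)
Definition stream l (j k : nat) : bool :=
  nth (fun=> false) (subst_prefix w l j.+1) j k.

Lemma streamE l n j : (j < size (subst_prefix w l n))%N ->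
  stream l j = nth (fun=> false) (subst_prefix w l n) j.
Proof.
move=> ltj; have ltj1 := leq_size_subst_prefix l j.+1.
apply/funext => k; rewrite /stream; congr (_ k).
by case: (leqP n j.+1) => [le|/ltnW le]; [|symmetry]; apply: nth_subst_prefix.
Qed.

Lemma stream_local l l' n j k : (forall i, (i < n)%N -> l i k = l' i k) ->
  (j < n)%N -> stream l j k = stream l' j k.
Proof.
move=> ll' ltjn; have ltj l1 := leq_trans ltjn (leq_size_subst_prefix l1 n).
rewrite !(@streamE _ n)// -!(@nth_map _ _ _ false (fun a => a k))//.
by rewrite (subst_prefix_proj l l').
Qed.

(** The position is that of the first variable in block [i]; it is the same for all [l] because
    substitution preserves lengths. *)
Lemma stream_var i : exists j, forall l, stream l j = l i.
Proof.
exists (size (subst_prefix w (fun=> fun=> false) i) + index None (w i))%N => l.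
rewrite (size_subst_prefix _ l) (@streamE _ i.+1).
  rewrite subst_prefixS nth_cat ltnNge leq_addr /= addKn /subst.
  by rewrite (nth_map None) ?index_mem// nth_index.
by rewrite subst_prefixS size_cat ltn_add2l /subst size_map index_mem.
Qed.

End stream.

(** * Assembling the subsequence and the perfect sets *)

Lemma finite_set_bits (i : nat) :
  finite_set [set a : nat -> bool | forall k, (i < k)%N -> a k = false].
Proof.
pose ext (t : {ffun 'I_i.+1 -> bool}) (k : nat) :=
  if (k < i.+1)%N then t (inord k) else false.
apply: (@sub_finite_set _ _ (range ext)).
  move=> a a0; exists [ffun k : 'I_i.+1 => a k] => //.
  apply/funext => k; rewrite /ext; case: ltnP => lek; last by rewrite a0.
  by rewrite ffunE inordK.
apply: finite_image; exact: finite_finset.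
Qed.

Lemma increasing_subseq (a : nat -> nat) :
  (forall m, exists n0, forall n, (n0 <= n)%N -> (m <= a n)%N) ->
  exists phi : nat -> nat, increasing_seq phi /\ increasing_seq (a \o phi).
Proof.
move=> a_oo; have /choice [next nextP] :
    forall n, exists n', (n < n')%N /\ (a n < a n')%N.
  move=> n; have [n0 n0P] := a_oo (a n).+1.
  by exists (maxn n0 n.+1); rewrite leq_maxr n0P// leq_maxl.
exists (fun i => iter i next 0%N).
by split; apply/increasing_seqP => i /=; have [] := nextP (iter i next 0%N).
Qed.

(** Take for [nu l] the largest [n <= l] such that [f n] varies by at most [2^-1 ^+ n] at scale
    [2^-1 ^+ l]. Each [m] qualifies for all large [l], by uniform continuity of [f m]. *)
Lemma prod_modulus_index (R : realType) (X : nat -> metricType R)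
    (Q : forall k, set (X k)) (f : nat -> prod_topology X -> R) :
  (forall k, compact (Q k)) -> (forall n, continuous (f n)) ->
  (forall n x, f n x \in `[0, 1]) ->
  exists nu : nat -> nat,
    (forall l (x y : prod_topology X), (forall k, Q k (x k)) ->
      (forall k, mdist (x k) (y k) < 2^-1 ^+ l) ->
      `|f (nu l) x - f (nu l) y| <= 2^-1 ^+ nu l) /\
    (forall m, exists l0, forall l, (l0 <= l)%N -> (m <= nu l)%N).
Proof.
move=> Qcompact fcont f01.
pose good l n := (n <= l)%N && `[< forall x y : prod_topology X,
  (forall k, Q k (x k)) -> (forall k, mdist (x k) (y k) < 2^-1 ^+ l) ->
  `|f n x - f n y| <= 2^-1 ^+ n >].
(* For [n = 0] the bound is [1], the length of the interval of values. *)
have good0 l : good l 0%N.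
  apply/andP; split=> //; apply/asboolP => x y _ _; rewrite expr0 ler_norml.
  have := f01 0%N x; have := f01 0%N y; rewrite !in_itv/=.
  by move=> /andP[h1 h2] /andP[h3 h4]; apply/andP; split; lra.
have /choice [nu nuP] : forall l, exists n, good l n /\
    forall m, good l m -> (m <= n)%N.
  move=> l; have ex : exists n, good l n by exists 0%N.
  have ub n : good l n -> (n <= l)%N by case/andP.
  by case: (ex_maxnP ex ub) => n gn nmax; exists n.
exists nu; split=> [l|m].
  by have [/andP[_ /asboolP]] := nuP l.
have e0 : 0 < 2^-1 ^+ m :> R by rewrite exprn_gt0// invr_gt0.
have [N NP] := compact_prod_modulus _ _ _ _ _ Qcompact (fcont m) e0.
exists (maxn N m) => l; rewrite geq_max => /andP[Nl ml].
have [_] := nuP l; apply; apply/andP; split=> //.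
by apply/asboolP => x y; exact: NP.
Qed.

Theorem mainTheorem1 (R : realType) (X : nat -> metricType R)
    (Q : forall k, set (X k))
    (Q_neq0 : forall k, Q k !=set0)
    (Q_perfect : forall k, compact_perfect (Q k))
    (f : nat -> prod_topology X -> R)
    (f_01 : forall n x, f n x \in `[0, 1])
    (f_cont : forall n, continuous (f n)) :
  exists (N : set nat) (n_ : nat -> nat) (P : forall k, set (X k)),
    [/\ infinite_set N,
        increasing_seq n_ /\ N = range n_,
        forall k, [/\ P k !=set0, compact_perfect (P k) & P k `<=` Q k] &
        forall x : prod_topology X, (forall k, P k (x k)) ->
          cvgn (fun i => f (n_ i) x)].
Proof.
have Qcompact k : compact (Q k) by have [] := Q_perfect k.
pose h k := projT1 (cid (cantor_scheme _ _ (Q k) (Q_neq0 k) (Q_perfect k))).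
have hP k : [/\ forall x, Q k (h k x), injective (h k) &
    forall n x y, (forall i, (i < n)%N -> x i = y i) ->
      mdist (h k x) (h k y) < 2^-1 ^+ n].
  by rewrite /h; case: cid.
have [nu [nu_mod nu_oo]] := prod_modulus_index _ _ _ _ Qcompact f_cont f_01.
pose pt (u : nat -> nat -> bool) : prod_topology X := fun k => h k (u^~ k).
pose F (u : seq (nat -> bool)) := f (nu (size u)) (pt (nth (fun=> false) u)).
have [w [w_var w_cvg]] := @infinite_hales_jewett R (nat -> bool) F
  (fun i => [set a : nat -> bool | forall k, (i < k)%N -> a k = false])
  (fun u => f_01 _ _) finite_set_bits.
pose len n := size (subst_prefix w (fun=> fun=> false) n).
have len_oo m : exists n0, forall n, (n0 <= n)%N -> (m <= nu (len n))%N.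
  have [l0 l0P] := nu_oo m; exists l0 => n nl0; apply: l0P.
  by apply: leq_trans nl0 _; exact: leq_size_subst_prefix.
have [phi [phi_inc n_inc]] := increasing_subseq (nu \o len) len_oo.
(* The [i]-th variable controls the coordinates [k <= i] only, so that the letters
   allowed for it form a finite set. *)
pose bits (k : nat) (x : nat -> bool) (i : nat) (_ : nat) := (k <= i)%N && x i.
(* Coordinate [k] reads only the [k]-th bits of the letters, so letters that are constant over the
   coordinates serve here. *)
pose g k (x : nat -> bool) : X k := h k (fun j => stream w (bits k x) j k).
exists (range (nu \o len \o phi)), (nu \o len \o phi), (fun k => range (g k)).
split=> //.
- move=> finN; apply: infinite_nat.
  have -> : [set: nat] = (nu \o len \o phi) @^-1` range (nu \o len \o phi).
    by apply/seteqP; split=> // i _; exists i.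
  apply: finite_preimage finN => i j _ _; exact: increasing_seq_injective.
- move=> k; have [hQ hinj hmod] := hP k; split.
  + by exists (g k (fun=> false)), (fun=> false).
  + apply: cantor_range_compact_perfect => [n x y xy|n x].
      apply: hmod => j ltjn; apply: stream_local ltjn => // i ltin.
      by rewrite /bits xy.
    (* The flipped bit lies at or beyond [n], which preserves the agreement, and at or beyond [k],
       where [bits] does not mask it. *)
    pose i := maxn n k; exists (fun j => if j == i then ~~ x j else x j).
    split=> [j ltjn|].
      by rewrite ifF//; apply/ltn_eqF/(leq_trans ltjn)/leq_maxl.
    have [j jP] := stream_var w w_var i.
    move=> /hinj /(congr1 (fun s => s j)) /=.
    by rewrite !jP /bits leq_maxr /= eqxx; case: (x i).
  + by move=> _ [x _ <-]; exact: hQ.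
move=> x xP; have [mu muE] : {mu : nat -> nat -> bool | forall k, g k (mu k) = x k}.
  by exists (fun k => s2val (cid2 (xP k))) => k; case: cid2.
(* The [k]-th bits of the letters are taken from the code [mu k] of [x k], so that a single sequence
   of letters names the whole point [x]. *)
pose l i k := bits k (mu k) i k.
have xE : x = pt (stream w l).
  apply: functional_extensionality_dep => k; rewrite -muE /g /pt; congr h.
  by apply/funext => j; apply: (@stream_local w w_var _ _ j.+1).
have l_cvg : cvgn (fun n => F (subst_prefix w l n)).
  by apply: w_cvg => i k ltik; rewrite /l /bits leqNgt ltik.
(* The point named by the finite prefix shares with [x] the first [len n] bits in every coordinate,
   so the two values of [f (nu (len n))] differ by at most [2^-1 ^+ nu (len n)]. *)
have dist_cvg : f (nu (len n)) x - F (subst_prefix w l n) @[n --> \oo] --> (0 : R).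
  apply/cvgrPdist_lt => e e0; have [m mP] := exp_half_lt _ _ e0.
  have [n0 n0P] := len_oo m; exists n0 => // n /n0P /mP; apply: le_lt_trans.
  rewrite sub0r normrN /F (size_subst_prefix _ _ (fun=> fun=> false)).
  apply: nu_mod => [k|k]; rewrite xE.
    by have [hQ _ _] := hP k; exact: hQ.
  have [_ _ hmod] := hP k; apply: hmod => j ltj.
  rewrite (@streamE w w_var l n)//.
  by rewrite (size_subst_prefix _ _ (fun=> fun=> false)).
have all_cvg : cvgn (fun n => f (nu (len n)) x).
  have -> : (fun n => f (nu (len n)) x) =
      (fun n => f (nu (len n)) x - F (subst_prefix w l n)) \+
      (fun n => F (subst_prefix w l n)).
    by apply/funext => n /=; rewrite subrK.
  by apply: is_cvgD => //; apply: cvgP dist_cvg.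
apply/cvg_ex; exists (limn (fun n => f (nu (len n)) x)).
apply: (cvg_comp phi (fun n => f (nu (len n)) x)) all_cvg.
move=> A [n0 _ n0A]; exists n0 => // i n0i; apply: n0A => /=.
apply: leq_trans n0i _; elim: i => // i IH.
by apply: leq_ltn_trans IH _; move/increasing_seqP: phi_inc; apply.
Qed.
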